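(* Let $\Gamma$ be a totally ordered set, $(A_\gamma)_{\gamma\in\Gamma}$ a family of ordered abelian groups, and $G=\coprod_{\gamma\in\Gamma}A_\gamma$ the Hahn sum, ordered lexicographically. Let $o\text{-}\mathrm{Aut}_\Gamma G$ be the set of order preserving automorphisms of $G$ that induce the identity on $\Gamma$, and let $\mathrm{Aut}_\Gamma S(G)$ be the group of automorphisms of the skeleton $S(G)=[\Gamma;\{A_\gamma:\gamma\in\Gamma\}]$ whose component on $\Gamma$ is the identity. Then $$o\text{-}\mathrm{Aut}_\Gamma G\simeq \mathrm{Int}\,\mathrm{Aut}\,G\rtimes\mathrm{Aut}_\Gamma S(G),$$ where $\mathrm{Int}\,\mathrm{Aut}\,G$ is the group of internal automorphisms of $G$. In particular, $o\text{-}\mathrm{Aut}_\Gamma G$ forms a group.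
   Context: The Hahn sum $\coprod_{\Gamma}A_\gamma$ is the group of all $a\in\prod_\Gamma A_\gamma$ with finite support $\operatorname{supp}(a)=\{\gamma:a_\gamma\ne0\}$. Elements are written $\sum_\gamma a_\gamma\mathbb{1}_\gamma:=(a_\gamma)_{\gamma\in\Gamma}$. The canonical valuation is $v(g)=\min\operatorname{supp}(g)$ for $g\neq0$, $v(0)=\infty$; the lexicographic order is: $g>0$ iff $g\ne0$ and $g_{v(g)}>0$ in $A_{v(g)}$. An automorphism $\sigma$ of $G$ is order preserving if $g>0\Rightarrow\sigma(g)>0$; it induces the identity on $\Gamma$ if $v(\sigma(g))=v(g)$ for all $g\in G$. An automorphism $\sigma$ of the group $G$ is internal if for all $g\ne 0$ in $G$: $v(\sigma(g))=v(g)$ and $\sigma(g)_{v(g)}=g_{v(g)}$ (equivalently, $\sigma$ is valuation preserving and induces the identity automorphism on the skeleton). An element of $\mathrm{Aut}_\Gamma S(G)$ is a family $(\tau_\gamma)_{\gamma\in\Gamma}$ with $\tau_\gamma$ an automorphism of the ordered group $A_\gamma$. The semidirect product is formed with respect to the conjugation action of $\mathrm{Aut}_\Gamma S(G)$ on $\mathrm{Int}\,\mathrm{Aut}\,G$, where $(\tau_\gamma)_{\gamma}$ is regarded as the automorphism $\sum_\gamma g_\gamma\mathbb{1}_\gamma\mapsto\sum_\gamma\tau_\gamma(g_\gamma)\mathbb{1}_\gamma$ of $G$ (its canonical lift). *)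

(* Defs.v *)
From HB Require Import structures.
From mathcomp Require Import all_boot all_order all_algebra.
From mathcomp Require Import mathcomp_extra boolp classical_sets cardinality.

Set Implicit Arguments.
Unset Strict Implicit.
Unset Printing Implicit Defensive.

Import Order.TTheory GRing.Theory.
Local Open Scope ring_scope.

Definition subgroup (G : groupType) (S : {pred G}) (Sgrp : group_closed S) :
  Type := {x : G | x \in S}.

Section Subgroup.
Variables (G : groupType) (S : {pred G}) (Sgrp : group_closed S).
HB.instance Definition _ := Choice.on (subgroup Sgrp).
HB.instance Definition _ := SubChoice.on (subgroup Sgrp).
HB.instance Definition _ :=
  SubChoice_isSubGroup.Build G (fun x => x \in S) (subgroup Sgrp) Sgrp.
End Subgroup.

Definition dprodg (I : Type) (H : I -> groupType) : Type := forall i, H i.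

Section DirectProduct.
Local Open Scope group_scope.
Variables (I : Type) (H : I -> groupType).
Implicit Types f g : dprodg H.

HB.instance Definition _ := Choice.on (dprodg H).

Let one : dprodg H := fun=> 1.
Let inv f : dprodg H := fun i => (f i)^-1.
Let mul f g : dprodg H := fun i => f i * g i.

Let mulA : associative mul.
Proof. by move=> f g h; apply: functional_extensionality_dep => i; apply: mulgA. Qed.
Let mul1 : left_id one mul.
Proof. by move=> f; apply: functional_extensionality_dep => i; apply: mul1g. Qed.
Let mulr1 : right_id one mul.
Proof. by move=> f; apply: functional_extensionality_dep => i; apply: mulg1. Qed.
Let mulV : left_inverse one inv mul.
Proof. by move=> f; apply: functional_extensionality_dep => i; apply: mulVg. Qed.
Let mulrV : right_inverse one inv mul.
Proof. by move=> f; apply: functional_extensionality_dep => i; apply: mulgV. Qed.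

HB.instance Definition _ :=
  isGroup.Build (dprodg H) mulA mul1 mulr1 mulV mulrV.
End DirectProduct.

Record grp_action (Q K : groupType) := GrpAction {
  gact :> Q -> K -> K;
  gact1 : forall k, gact 1%g k = k;
  gactM : forall p q k, gact (p * q)%g k = gact p (gact q k);
  gact_mul : forall q, {morph gact q : k l / (k * l)%g}
}.

(* External semidirect product K ><| Q for the action a of Q on K. *)
Definition semidirect (Q K : groupType) (a : grp_action Q K) : Type :=
  (K * Q)%type.

Section Semidirect.
Local Open Scope group_scope.
Variables (Q K : groupType) (a : grp_action Q K).
Implicit Types x y : semidirect a.

HB.instance Definition _ := Choice.on (semidirect a).

Let one : semidirect a := (1, 1).
Let inv x : semidirect a := (a x.2^-1 x.1^-1, x.2^-1).
Let mul x y : semidirect a := (x.1 * a x.2 y.1, x.2 * y.2).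

Let gact_one q : a q 1 = 1.
Proof. by apply: (mulgI (a q 1)); rewrite -gact_mul !mulg1. Qed.
Let mulA : associative mul.
Proof.
by move=> [k1 q1] [k2 q2] [k3 q3]; rewrite /mul /= gact_mul gactM !mulgA.
Qed.
Let mul1 : left_id one mul.
Proof. by move=> [k q]; rewrite /mul /= gact1 !mul1g. Qed.
Let mulr1 : right_id one mul.
Proof. by move=> [k q]; rewrite /mul /= gact_one !mulg1. Qed.
Let mulV : left_inverse one inv mul.
Proof. by move=> [k q]; rewrite /mul /inv /= -gact_mul !mulVg gact_one. Qed.
Let mulrV : right_inverse one inv mul.
Proof. by move=> [k q]; rewrite /mul /inv /= -gactM !mulgV gact1 mulgV. Qed.

HB.instance Definition _ :=
  isGroup.Build (semidirect a) mulA mul1 mulr1 mulV mulrV.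
End Semidirect.

Definition group_iso (G H : groupType) : Prop :=
  exists f : {multiplicative G -> H}, bijective f.

HB.mixin Record isOrderedZmodule G of Num.POrderedZmodule G := {
  lez_total : total (<=%R : rel G);
  lezD2l : forall x y z : G, x <= y -> z + x <= z + y
}.

(* Totally ordered abelian groups; the zero group is allowed. *)
#[short(type="oZmodType")]
HB.structure Definition OrderedZmodule :=
  {G of Num.POrderedZmodule G & isOrderedZmodule G}.

Record zaut (V : zmodType) := ZAut {
  zaut_fun :> {additive V -> V};
  zaut_bij : bijective zaut_fun
}.

Section ZAut.
Variable V : zmodType.
Implicit Types s t : zaut V.

Lemma zautP s t : (forall x, s x = t x) -> s = t.
Proof.
case: s t => [[f [[Hf]]] bf] [[g [[Hg]]] bg] /= fg.
have efg : f = g by apply: funext.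
move: Hf bf; rewrite efg => Hf; rewrite (Prop_irrelevance Hf Hg) => bf.
by rewrite (Prop_irrelevance bf bg).
Qed.

Definition mk_zaut (f : V -> V) (Df : zmod_morphism f) (bf : bijective f) :
    zaut V :=
  let F : {additive V -> V} :=
    HB.pack f (GRing.isZmodMorphism.Build V V f Df) in
  @ZAut V F bf.

HB.instance Definition _ := gen_eqMixin (zaut V).
HB.instance Definition _ := gen_choiceMixin (zaut V).

Definition zaut1 : zaut V :=
  @mk_zaut idfun (fun _ _ => erefl) (Bijective (fun=> erefl) (fun=> erefl)).

Let comp_additive s t : zmod_morphism (s \o t).
Proof. by move=> x y /=; rewrite !raddfB. Qed.
Definition zautM s t : zaut V :=
  mk_zaut (@comp_additive s t) (bij_comp (zaut_bij s) (zaut_bij t)).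

Let inv_sig s : {g : V -> V | cancel s g /\ cancel g s}.
Proof. by apply: cid; case: (zaut_bij s) => g ? ?; exists g. Qed.
Let inv_additive s : zmod_morphism (sval (inv_sig s)).
Proof. by case: inv_sig => g [sK Ks] /=; apply: can2_zmod_morphism Ks. Qed.
Let inv_bij s : bijective (sval (inv_sig s)).
Proof. by case: inv_sig => g [sK Ks] /=; exists s. Qed.
Definition zautV s : zaut V := mk_zaut (@inv_additive s) (@inv_bij s).

Let zautA : associative zautM.
Proof. by move=> s t u; apply: zautP. Qed.
Let zaut1M : left_id zaut1 zautM.
Proof. by move=> s; apply: zautP. Qed.
Let zautM1 : right_id zaut1 zautM.
Proof. by move=> s; apply: zautP. Qed.
Let zautVM : left_inverse zaut1 zautV zautM.
Proof.
by move=> s; apply: zautP => x /=; case: inv_sig => g [sK Ks] /=; apply: sK.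
Qed.
Let zautMV : right_inverse zaut1 zautV zautM.
Proof.
by move=> s; apply: zautP => x /=; case: inv_sig => g [sK Ks] /=; apply: Ks.
Qed.

(* The product s * t is the composite s \o t. *)
HB.instance Definition _ :=
  isGroup.Build (zaut V) zautA zaut1M zautM1 zautVM zautMV.

Lemma zaut_mulE s t x : (s * t)%g x = s (t x). Proof. by []. Qed.
Lemma zaut_oneE x : (1%g : zaut V) x = x. Proof. by []. Qed.
Lemma zautK s : cancel s (s^-1)%g.
Proof. by move=> x; rewrite -zaut_mulE mulVg. Qed.
Lemma zautVK s : cancel (s^-1)%g s.
Proof. by move=> x; rewrite -zaut_mulE mulgV. Qed.
End ZAut.

Section OrderedAut.
Variable V : oZmodType.

Definition is_oaut : {pred zaut V} := fun s => `[< {mono s : x y / x <= y} >].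

Lemma oaut_group : group_closed is_oaut.
Proof.
split=> [|s t /asboolP sm /asboolP tm]; apply/asboolP => // x y.
by rewrite !zaut_mulE sm -tm !zautVK.
Qed.

Definition oaut : groupType := subgroup oaut_group.
End OrderedAut.

Definition hahn_prod (T : Type) (A : T -> zmodType) : Type := forall i, A i.

Section HahnProd.
Variables (T : Type) (A : T -> zmodType).
Implicit Types f g : hahn_prod A.

HB.instance Definition _ := Choice.on (hahn_prod A).

Let zero : hahn_prod A := fun=> 0.
Let opp f : hahn_prod A := fun i => - f i.
Let add f g : hahn_prod A := fun i => f i + g i.

Let addA : associative add.
Proof. by move=> f g h; apply: functional_extensionality_dep => i; apply: addrA. Qed.
Let addC : commutative add.
Proof. by move=> f g; apply: functional_extensionality_dep => i; apply: addrC. Qed.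
Let add0 : left_id zero add.
Proof. by move=> f; apply: functional_extensionality_dep => i; apply: add0r. Qed.
Let addN : left_inverse zero opp add.
Proof. by move=> f; apply: functional_extensionality_dep => i; apply: addNr. Qed.

HB.instance Definition _ :=
  GRing.isZmodule.Build (hahn_prod A) addA addC add0 addN.
End HahnProd.

Definition supp (T : Type) (A : T -> zmodType) (f : forall i, A i) : set T :=
  [set i | f i <> 0].

Definition set_min d (T : porderType d) (S : set T) : option T :=
  if pselect (exists x, S x /\ lbound S x) is left ex
  then Some (projT1 (cid ex)) else None.

Section HahnSum.
Variables (d : Order.disp_t) (Gamma : orderType d) (A : Gamma -> oZmodType).

Definition fin_supp : {pred hahn_prod A} := fun f => `[< finite_set (supp f) >].

Record hahn_sum := HahnSum { hahn_val : hahn_prod A; _ : hahn_val \in fin_supp }.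

HB.instance Definition _ := [isSub for hahn_val].
HB.instance Definition _ := [Choice of hahn_sum by <:].

Fact fin_supp_zmod_closed : zmod_closed fin_supp.
Proof.
split=> [|f g /asboolP ff /asboolP fg]; apply/asboolP.
  by rewrite (_ : supp _ = set0) //; apply/seteqP; split=> // i /=; apply.
apply: sub_finite_set (_ : _ `<=` supp f `|` supp g)%classic _.
  move=> i /= fgi; case: (pselect (f i = 0)) => [fi0|]; last by left.
  by right=> gi0; apply: fgi; rewrite [LHS](_ : _ = f i - g i) // fi0 gi0 subr0.
by rewrite finite_setU.
Qed.

HB.instance Definition _ :=
  GRing.SubChoice_isSubZmodule.Build _ fin_supp hahn_sum fin_supp_zmod_closed.

Definition coord (g : hahn_sum) : forall i, A i := hahn_val g.
Coercion coord : hahn_sum >-> Funclass.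
Implicit Types (f g h : hahn_sum) (i j : Gamma).

Lemma hahnP f g : (forall i, f i = g i) -> f = g.
Proof. by move=> fg; apply/val_inj/functional_extensionality_dep. Qed.
Lemma finite_supp g : finite_set (supp g).
Proof. by case: g => f /= /asboolP. Qed.
Lemma coord0 i : (0 : hahn_sum) i = 0. Proof. by []. Qed.
Lemma coordD f g i : (f + g) i = f i + g i. Proof. by []. Qed.
Lemma coordN f i : (- f) i = - f i. Proof. by []. Qed.
Lemma coordB f g i : (f - g) i = f i - g i. Proof. by []. Qed.

(* The canonical valuation; None stands for infinity. *)
Definition v g : option Gamma := set_min (supp g).

Lemma v_SomeP g i :
  v g = Some i <-> g i <> 0 /\ (forall j, (j < i)%O -> g j = 0).
Proof.
rewrite /v /set_min; split.
  case: pselect => // ex [<-]; case: cid => k [/= gk lbk] /=; split=> // j jk.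
  by apply: contrapT => /lbk; rewrite leNgt jk.
move=> [gi lti]; case: pselect => [ex|[]]; last first.
  exists i; split=> // j gj; rewrite leNgt; apply/negP => /lti; exact: gj.
congr Some; case: cid => k [/= gk lbk] /=; apply/le_anti; rewrite lbk //=.
by rewrite leNgt; apply/negP => /lti.
Qed.

Lemma v_None g : v g = None <-> g = 0.
Proof.
split=> [|->]; last first.
  by case vg: (v 0) => [i|//]; move/v_SomeP: vg => -[].
rewrite /v /set_min; case: pselect => // nex _; apply: hahnP => i.
apply: contrapT => gi; apply: nex.
have /finite_seqP[s0 gs0] := finite_supp g.
pose s := sort <=%O s0.
have gs : supp g = [set` s]%classic.
  by rewrite gs0; apply/seteqP; split=> j /=; rewrite mem_sort.
have : sorted <=%O s by apply: sort_le_sorted.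
have : supp g i by [].
rewrite gs; case: s gs => [|k t] gs //= _ kt; exists k; split.
  exact: mem_head.
move=> j /=; rewrite inE => /predU1P[->//|jt].
by apply: (allP (order_path_min _ kt)) => //; apply: le_trans.
Qed.

Definition lex_pos g : bool := if v g is Some i then 0 < g i else false.
Let lex_lt f g : bool := lex_pos (g - f).
Let lex_le f g : bool := (f == g) || lex_lt f g.

Let oz_gt0D (V : oZmodType) (x y : V) : 0 < x -> 0 < y -> 0 < x + y.
Proof.
move=> x0 y0; apply: lt_le_trans x0 _.
by rewrite -[leLHS]addr0; apply: lezD2l; apply: ltW.
Qed.
Let oz_lt0N (V : oZmodType) (x : V) : x < 0 -> 0 < - x.
Proof.
move=> x0; rewrite lt_neqAle eq_sym oppr_eq0 lt_eqF //=.
by rewrite -(addNr x) -[leRHS]addr0; apply: lezD2l; apply: ltW.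
Qed.

Lemma lex_posP g :
  reflect (exists i, (forall j, (j < i)%O -> g j = 0) /\ 0 < g i) (lex_pos g).
Proof.
rewrite /lex_pos; apply: (iffP idP).
  by case vg: (v g) => [i|//] gi; exists i; case/v_SomeP: vg.
move=> [i [lti gi]]; suff -> : v g = Some i by [].
by apply/v_SomeP; split=> // gi0; rewrite gi0 ltxx in gi.
Qed.

Let lex_posD f g : lex_pos f -> lex_pos g -> lex_pos (f + g).
Proof.
move=> /lex_posP[i [fi0 fi]] /lex_posP[j [gj0 gj]]; apply/lex_posP.
case: (ltgtP i j) => ij.
- exists i; split; last by rewrite coordD gj0 // addr0.
  by move=> k ki; rewrite coordD fi0 // gj0 ?addr0 //; apply: lt_trans ij.
- exists j; split; last by rewrite coordD fi0 // add0r.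
  by move=> k kj; rewrite coordD gj0 // fi0 ?addr0 //; apply: lt_trans ij.
- subst j; exists i; split; last by rewrite coordD oz_gt0D.
  by move=> k ki; rewrite coordD gj0 // fi0 ?addr0.
Qed.

Let lex_le_def f g : lex_le f g = (f == g) || lex_lt f g.
Proof. by []. Qed.
Let lex_lt_irr : irreflexive lex_lt.
Proof.
move=> f; rewrite /lex_lt subrr; apply/negP => /lex_posP[i [_]].
by rewrite coord0 ltxx.
Qed.
Let lex_lt_trans : transitive lex_lt.
Proof.
move=> g f h fg gh; rewrite /lex_lt -(subrKA g) addrC; exact: lex_posD.
Qed.

HB.instance Definition _ := Order.LtLe_isPOrder.Build ring_display hahn_sum
  lex_le_def lex_lt_irr lex_lt_trans.

Let lex_total : total (<=%R : rel hahn_sum).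
Proof.
move=> f g; rewrite !le_eqVlt eq_sym.
have [//|gf /=] := eqVneq g f.
have vgf : v (g - f) <> None.
  by move/v_None/eqP; rewrite subr_eq0 (negPf gf).
case vi : (v (g - f)) vgf => [i|//] _; case/v_SomeP: vi => gfi lti.
have gi0 : (g - f) i != 0 by apply/eqP.
have /orP[gi|gi] := lez_total ((g - f) i) 0; apply/orP; [right|left].
  apply/lex_posP; exists i; rewrite -opprB; split.
    by move=> j /lti e; rewrite coordN e oppr0.
  by apply: oz_lt0N; rewrite lt_neqAle gi0.
by apply/lex_posP; exists i; rewrite lt_neqAle eq_sym gi0.
Qed.

Let lex_leD2l f g h : f <= g -> h + f <= h + g.
Proof.
rewrite !le_eqVlt => /predU1P[->|fg]; first by rewrite eqxx.
apply/orP; right; suff : lex_pos (h + g - (h + f)) by [].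
by rewrite opprD addrACA subrr add0r.
Qed.

HB.instance Definition _ := isOrderedZmodule.Build hahn_sum lex_total lex_leD2l.

Lemma hahn_gt0E g : (0 < g) = lex_pos g.
Proof. by rewrite -{2}(subr0 g). Qed.

Implicit Types s t : zaut hahn_sum.

Definition order_preserving s : Prop := forall g, 0 < g -> 0 < s g.

Definition identity_on_Gamma s : Prop := forall g, v (s g) = v g.

Definition internal s : Prop :=
  forall g, g <> 0 -> v (s g) = v g /\ (forall i, v g = Some i -> s g i = g i).

Definition is_oAut : {pred zaut hahn_sum} :=
  fun s => `[< order_preserving s /\ identity_on_Gamma s >].

Definition is_intAut : {pred zaut hahn_sum} := fun s => `[< internal s >].

Lemma intAut_group : group_closed is_intAut.
Proof.
split=> [|s t /asboolP is_ /asboolP it]; apply/asboolP => // g g0.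
have tg0 : (t^-1)%g g <> 0.
  by move=> tg; apply: g0; rewrite -(zautVK t g) tg raddf0.
have [vt ct] := it _ tg0; have [vs cs] := is_ _ tg0.
rewrite zautVK in vt ct; rewrite zaut_mulE vs -vt; split=> // i vi.
by rewrite cs -?ct // -vt.
Qed.

Definition intAut : groupType := subgroup intAut_group.

(* An automorphism of the skeleton [Gamma; A] whose component on Gamma is the
   identity is a family of automorphisms of the ordered groups A i. *)
Definition skelAut : groupType := dprodg (fun i => oaut (A i)).
Implicit Types tau : skelAut.

Let tau_fun tau (i : Gamma) : zaut (A i) := val (tau i).

Let lift_fin tau g : (fun i => tau_fun tau i (g i)) \in fin_supp.
Proof.
apply/asboolP; apply: sub_finite_set (finite_supp g) => i /=.
by apply: contra_not => ->; rewrite raddf0.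
Qed.

Definition lift_fun tau g : hahn_sum := HahnSum (lift_fin tau g).

Let lift_additive tau : zmod_morphism (lift_fun tau).
Proof. by move=> f g; apply: hahnP => i; apply: raddfB. Qed.

Let lift_bij tau : bijective (lift_fun tau).
Proof.
exists (lift_fun (tau^-1)%g) => g; apply: hahnP => i.
  exact: (zautK (val (tau i))).
exact: (zautVK (val (tau i))).
Qed.

Definition lift tau : zaut hahn_sum :=
  mk_zaut (@lift_additive tau) (lift_bij tau).

Lemma liftE tau g i : lift tau g i = val (tau i) (g i).
Proof. by []. Qed.

Lemma liftM tau tau' : lift (tau * tau')%g = (lift tau * lift tau')%g.
Proof. by apply: zautP => g; apply: hahnP. Qed.

Lemma lift1 : lift 1%g = 1%g.
Proof. by apply: zautP => g; apply: hahnP. Qed.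

Lemma v_lift tau g : v (lift tau g) = v g.
Proof.
have tau0 i x : val (tau i) x = 0 -> x = 0.
  by move=> t0; apply: (can_inj (zautK (val (tau i)))); rewrite t0 raddf0.
case vg: (v g) => [i|]; last first.
  by move/v_None: vg => ->; rewrite raddf0; apply/v_None.
case/v_SomeP: vg => gi lti; apply/v_SomeP; rewrite liftE; split.
  by move/tau0.
by move=> j /lti gj; rewrite liftE gj raddf0.
Qed.

Let conj_intAut tau (u : intAut) :
  (lift tau * val u * (lift tau)^-1)%g \in is_intAut.
Proof.
case: u => s sI /=; have /asboolP is_ := sI; apply/asboolP => g g0.
set h := ((lift tau)^-1)%g g; have gE : g = lift tau h by rewrite zautVK.
have h0 : h <> 0 by move=> h0; apply: g0; rewrite gE h0 raddf0.
have [vs cs] := is_ _ h0; rewrite !zaut_mulE -/h v_lift vs {1}gE v_lift.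
by split=> // i; rewrite gE v_lift => vi; rewrite !liftE cs.
Qed.

(* Conjugation by the canonical lift: u |-> lift tau \o u \o (lift tau)^-1. *)
Definition conj_fun tau (u : intAut) : intAut :=
  exist (fun s => s \in is_intAut) _ (conj_intAut tau u).

Let conj1 (u : intAut) : conj_fun 1%g u = u.
Proof. by apply: val_inj; rewrite /= lift1 invg1 mulg1 mul1g. Qed.
Let conjM tau tau' (u : intAut) :
  conj_fun (tau * tau')%g u = conj_fun tau (conj_fun tau' u).
Proof. by apply: val_inj; rewrite /= liftM invgM !mulgA. Qed.
Let conj_mul tau : {morph conj_fun tau : u w / (u * w)%g}.
Proof. by move=> u w; apply: val_inj; rewrite /= !mulgA mulgVK. Qed.

Definition conj_action : grp_action skelAut intAut :=
  GrpAction conj1 conjM conj_mul.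

End HahnSum.

Arguments is_oAut {d Gamma} A.
Arguments is_intAut {d Gamma} A.
Arguments intAut {d Gamma} A.
Arguments skelAut {d Gamma} A.
Arguments conj_action {d Gamma} A.

(* Main.v *)
Require Import Defs.
From HB Require Import structures.
From mathcomp Require Import all_boot all_order all_algebra.
From mathcomp Require Import mathcomp_extra boolp classical_sets cardinality.

(** The group [oAut] of order preserving automorphisms that fix every value
    [v g] is split over its normal subgroup [intAut] by the canonical lift.

    An automorphism [s] that preserves [v] is triangular: the coordinate of
    [s g] at [i] depends only on the coordinates of [g] at the indices [<= i],
    because a difference of larger value is sent to one of the same value
    ([coord_eq_upto]).  In particular, on the elements that vanish below [i],
    the coordinate at [i] of [s g] is a function of [g i] alone, the diagonal
    entry [diag s i] of [s] ([coord_diag]).  Diagonal entries multiply like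
    those of triangular matrices ([diagM]), so [diag (s^-1) i] inverts
    [diag s i], and [diag s i] is an order automorphism of [A i] as soon as
    [s] preserves the order.  This gives a homomorphism [skel] from [oAut] to
    [skelAut], for which [lift] is a section.  Its kernel consists of the
    triangular automorphisms with identity diagonal, that is, of the internal
    ones, so [s |-> (s * (lift (skel s))^-1, skel s)] is the isomorphism, with
    inverse [(u, tau) |-> u * lift tau].

    That [oAut] contains inverses uses totality of the order: an additive
    injection that preserves positivity also reflects it ([additive_mono]). *)

Set Implicit Arguments.
Unset Strict Implicit.
Unset Printing Implicit Defensive.

Import Order.TTheory GRing.Theory.
Local Open Scope ring_scope.

(** * Ordered groups *)

Lemma oz_subr_gt0 (V : oZmodType) (x y : V) : (0 < y - x) = (x < y).
Proof.
have mono (a b c : V) : a < b -> c + a < c + b.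
  by rewrite !lt_def (inj_eq (addrI c)) => /andP[-> /lezD2l ->].
apply/idP/idP => [/(mono _ _ x)|/(mono _ _ (- x))].
  by rewrite addr0 addrC subrK.
by rewrite addNr addrC.
Qed.

(** Being additive, [f] is strictly increasing; as the order on [V] is total,
    [f] then reflects it too. *)
Lemma additive_mono (V W : oZmodType) (f : {additive V -> W}) :
  (forall x, 0 < x -> 0 < f x) -> {mono f : x y / x <= y}.
Proof.
move=> fpos; have homo x y : x < y -> f x < f y.
  by rewrite -oz_subr_gt0 => /fpos; rewrite raddfB oz_subr_gt0.
move=> x y; have [xy|/negP nxy] := boolP (x <= y).
  by move: xy; rewrite !le_eqVlt => /predU1P[->|/homo ->];
    rewrite ?eqxx ?orbT.
have yx : y < x.
  have := lez_total x y; rewrite (negPf (introN idP nxy)) /= le_eqVlt.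
  by case/predU1P=> // yx; case: nxy; rewrite yx.
by apply/negbTE/negP => /(lt_le_trans (homo _ _ yx)); rewrite ltxx.
Qed.

Section HahnSumAut.
Variables (d : Order.disp_t) (Gamma : orderType d) (A : Gamma -> oZmodType).
Implicit Types (g h : hahn_sum A) (i j : Gamma) (s t : zaut (hahn_sum A)).

(** * The group of order preserving automorphisms *)

Lemma order_preserving_mono s : order_preserving s -> {mono s : x y / x <= y}.
Proof. exact: additive_mono. Qed.

Lemma oAut_group : group_closed (is_oAut A).
Proof.
split; first by apply/asboolP; split.
move=> s t /asboolP[os vs] /asboolP[ot vt]; apply/asboolP; split=> g.
  move=> g0; apply: os.
  by rewrite -(leW_mono (order_preserving_mono ot)) raddf0 zautVK.
by rewrite zaut_mulE vs -vt zautVK.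
Qed.

Local Notation oAut := (subgroup oAut_group).
Implicit Types (a b : oAut) (tau : skelAut A) (u : intAut A).

Lemma oAut_op a : order_preserving (val a).
Proof. by case: a => s /= /asboolP[]. Qed.

Lemma oAut_v a : identity_on_Gamma (val a).
Proof. by case: a => s /= /asboolP[]. Qed.

Lemma intAut_v u : identity_on_Gamma (val u).
Proof.
case: u => s /= /asboolP sI g; have [->|/eqP g0] := eqVneq g 0.
  by rewrite raddf0.
by case: (sI _ g0).
Qed.

(** * Diagonal entries of valuation preserving automorphisms *)

Lemma single_fin i (x : A i) :
  (eqtype.dfwith (fun j => 0 : A j) x : hahn_prod A) \in @fin_supp _ _ A.
Proof.
apply/asboolP/(sub_finite_set _ (finite_set1 i)) => j /= jx.
by apply: contrapT => /eqP ji; apply: jx; rewrite dfwith_out // eq_sym.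
Qed.

(** The element written [x 1_i] in the usual notation for Hahn sums. *)
Definition single i (x : A i) : hahn_sum A := HahnSum (single_fin x).

Lemma single_in i (x : A i) : single x i = x.
Proof. exact: dfwith_in. Qed.

Lemma single_out i (x : A i) j : j != i -> single x j = 0.
Proof. by rewrite eq_sym; apply: dfwith_out. Qed.

Lemma single_below i (x : A i) j : (j < i)%O -> single x j = 0.
Proof. by move=> ji; rewrite single_out // lt_eqF. Qed.

Lemma singleB i : zmod_morphism (@single i).
Proof.
move=> x y; apply: hahnP => j; rewrite coordB.
have [->|ji] := eqVneq j i; first by rewrite !single_in.
by rewrite !single_out // subr0.
Qed.

(** The difference of [g] and [h] has value above [i] or is zero, and so does
    its image under [s]. *)
Lemma coord_eq_upto s g h i : identity_on_Gamma s ->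
  (forall j, (j <= i)%O -> g j = h j) -> s g i = s h i.
Proof.
move=> vs gh; apply/eqP; rewrite -subr_eq0 -coordB -raddfB.
case vgh: (v (g - h)) => [k|]; last first.
  by move/v_None: vgh => ->; rewrite raddf0.
have ik : (i < k)%O.
  rewrite ltNge; apply/negP => /gh ghk; have /v_SomeP[] := vgh.
  by rewrite coordB ghk subrr.
by rewrite -vs in vgh; have /v_SomeP[_ ->] := vgh.
Qed.

Definition diag s i (x : A i) : A i := s (single x) i.

Lemma coord_diag s g i : identity_on_Gamma s ->
  (forall j, (j < i)%O -> g j = 0) -> s g i = diag s (g i).
Proof.
move=> vs g0; apply: coord_eq_upto => // j; rewrite le_eqVlt.
case/predU1P=> [->|ji]; first by rewrite single_in.
by rewrite g0 // single_below.
Qed.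

Lemma coord_below s g i : identity_on_Gamma s ->
  (forall j, (j < i)%O -> g j = 0) -> forall j, (j < i)%O -> s g j = 0.
Proof.
move=> vs g0 j ji; rewrite -(Defs.coord0 A j) -(raddf0 s).
by apply: coord_eq_upto => // k kj; apply/g0/le_lt_trans/ji.
Qed.

(** The image of [single x] under [t] vanishes below [i], so [s] acts on its
    coordinate at [i] through [diag s]. *)
Lemma diagM s t i (x : A i) : identity_on_Gamma s -> identity_on_Gamma t ->
  diag (s * t)%g x = diag s (diag t x).
Proof.
move=> vs vt; apply: (coord_diag (g := t (single x))) => //.
by apply: coord_below => // j; apply: single_below.
Qed.

Lemma diag1 i (x : A i) : diag 1%g x = x.
Proof. exact: single_in. Qed.

Lemma diagB s i : zmod_morphism (@diag s i).
Proof. by move=> x y; rewrite /diag singleB raddfB. Qed.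

Lemma diag_lift tau i (x : A i) : diag (Defs.lift tau) x = val (tau i) x.
Proof. by rewrite /diag liftE single_in. Qed.

Lemma v_single i (x : A i) : x <> 0 -> v (single x) = Some i.
Proof.
by move=> x0; apply/v_SomeP; rewrite single_in; split=> // j /single_below.
Qed.

Lemma diag_intAut u i (x : A i) : diag (val u) x = x.
Proof.
have [->|/eqP x0] := eqVneq x 0; first by rewrite -(subrr 0) diagB !subrr.
case: u => s /= /asboolP sI; rewrite /diag; have vx := v_single x0.
have /sI[_ /(_ _ vx) ->] : single x <> 0 by move/v_None; rewrite vx.
exact: single_in.
Qed.

(** A positive element of value [i] has a positive image of the same value,
    and positivity of an element is read off at its value. *)
Lemma diag_gt0 a i (x : A i) : 0 < x -> 0 < diag (val a) x.
Proof.
move=> x0; have vx : v (single x) = Some i.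
  by apply: v_single => x00; rewrite x00 ltxx in x0.
have := @oAut_op a (single x).
rewrite !hahn_gt0E /lex_pos (oAut_v a) vx single_in; exact.
Qed.

(** * The homomorphism to the skeleton *)

Lemma diag_bij a i : bijective (@diag (val a) i).
Proof.
exists (@diag (val a^-1)%g i) => x; rewrite -diagM; try exact: oAut_v.
  by rewrite -valM mulVg diag1.
by rewrite -valM mulgV diag1.
Qed.

Definition diag_zaut a i : zaut (A i) :=
  mk_zaut (@diagB (val a) i) (@diag_bij a i).

Lemma diag_oaut a i : diag_zaut a i \in @is_oaut (A i).
Proof. by apply/asboolP/additive_mono => x; apply: diag_gt0. Qed.

Definition skel a : skelAut A :=
  fun i => exist (fun r => r \in @is_oaut (A i)) _ (diag_oaut a i).

Lemma skelE a i (x : A i) : val (skel a i) x = diag (val a) x.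
Proof. by []. Qed.

Lemma skelAutP tau tau' :
  (forall i x, val (tau i) x = val (tau' i) x) -> tau = tau'.
Proof.
move=> tt'; apply: functional_extensionality_dep => i.
by apply/val_inj/zautP => x.
Qed.

Lemma skelM : {morph skel : a b / (a * b)%g}.
Proof.
by move=> a b; apply: skelAutP => i x; apply: diagM; apply: oAut_v.
Qed.

(** * The splitting *)

Lemma mul_lift_oAut u tau : (val u * Defs.lift tau)%g \in is_oAut A.
Proof.
have vul : identity_on_Gamma (val u * Defs.lift tau)%g.
  by move=> g; rewrite zaut_mulE intAut_v v_lift.
apply/asboolP; split=> // g; rewrite !hahn_gt0E /lex_pos vul.
case vg: (v g) => [i|//]; have /v_SomeP[_ g0] := vg.
rewrite coord_diag // diagM ?diag_intAut ?diag_lift; last 2 first.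
- exact: intAut_v.
- exact: v_lift.
case: (tau i) => /= r /asboolP rm gi.
by rewrite -(raddf0 r) (leW_mono rm).
Qed.

Definition mul_lift u tau : oAut :=
  exist (fun s => s \in is_oAut A) _ (mul_lift_oAut u tau).

Lemma skel_mul_lift u tau : skel (mul_lift u tau) = tau.
Proof.
apply: skelAutP => i x; rewrite skelE /= diagM ?diag_intAut ?diag_lift //.
  exact: intAut_v.
exact: v_lift.
Qed.

(** Dividing by the lift of its own skeleton makes the diagonal of [a]
    trivial. *)
Lemma internal_part_intAut a :
  (val a * (Defs.lift (skel a))^-1)%g \in is_intAut A.
Proof.
have vw : identity_on_Gamma (val a * (Defs.lift (skel a))^-1)%g.
  by move=> g; rewrite zaut_mulE (oAut_v a) -(v_lift (skel a)) zautVK.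
apply/asboolP => g _; split=> // i; rewrite -(zautVK (Defs.lift (skel a)) g).
set h := ((Defs.lift (skel a))^-1)%g g.
rewrite zaut_mulE zautK v_lift liftE skelE => /v_SomeP[_ h0].
by apply: coord_diag => //; apply: oAut_v.
Qed.

Definition internal_part a : intAut A :=
  exist (fun s => s \in is_intAut A) _ (internal_part_intAut a).

Definition split_oAut a : semidirect (conj_action A) :=
  (internal_part a, skel a).

(** In [a * b], the internal part of [b] stands to the right of the lift of
    [skel a]; moving it to the left conjugates it by that lift, which is the
    action defining the semidirect product. *)
Lemma split_oAutM : {morph split_oAut : a b / (a * b)%g}.
Proof.
move=> a b; apply: (congr2 pair); last exact: skelM.
by apply: val_inj => /=; rewrite skelM liftM invgM !mulgA mulgVK.
Qed.

Lemma split_oAutK : cancel split_oAut (fun p => mul_lift p.1 p.2).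
Proof. by move=> a; apply: val_inj; rewrite /= mulgVK. Qed.

Lemma mul_liftK : cancel (fun p => mul_lift p.1 p.2) split_oAut.
Proof.
move=> [u tau]; apply: (congr2 pair); last exact: skel_mul_lift.
by apply: val_inj; rewrite /= skel_mul_lift mulgK.
Qed.

HB.instance Definition _ :=
  isMultiplicative.Build oAut (semidirect (conj_action A)) split_oAut
    split_oAutM.

End HahnSumAut.

Theorem theorem4p5 (d : Order.disp_t) (Gamma : orderType d)
    (A : Gamma -> oZmodType) :
  exists oAut_group : group_closed (is_oAut A),
    group_iso (subgroup oAut_group) (semidirect (conj_action A)).
Proof.
exists (oAut_group A), (@split_oAut d Gamma A).
exact: Bijective (@split_oAutK _ _ A) (@mul_liftK _ _ A).
Qed.
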